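(* Let $k$ be a positive integer. Then there exists $N$ (depending on $k$) such that for every integer $n>\max(k,N)$ with $\gcd(k,n)=1$ and every $m\in\{0,1,\ldots,n-1\}$ with $\gcd(m,n)=1$, the inequality $S(m,n)\ge S(k,n)$ holds only if $m$ can be written in the form $$m=\frac{nc+q}{d}$$ with integers $d\in\{1,\ldots,k\}$, $c\in\{0,1,\ldots,d-1\}$ with $\gcd(c,d)=1$, and $q\in\{1,\ldots,\lfloor k/d\rfloor\}$.
   Context: For integers $m,n$ with $n\neq 0$ and $\gcd(m,n)=1$, the Dedekind sum is $s(m,n)=\sum_{j=1}^{|n|}((j/n))((mj/n))$, where $((t))=t-\lfloor t\rfloor-1/2$ if $t\in\mathbb{R}\setminus\mathbb{Z}$ and $((t))=0$ if $t\in\mathbb{Z}$. Define $S(m,n)=12\,s(m,n)$. *)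

(* Defs.v *)
From mathcomp Require Import all_boot all_order all_algebra.
Set Implicit Arguments. Unset Strict Implicit. Unset Printing Implicit Defensive.
Import Order.TTheory GRing.Theory Num.Theory.
Local Open Scope ring_scope.

Definition sawtooth (t : rat) : rat :=
  if t \is a Num.int then 0 else t - (Num.floor t)%:~R - 2^-1.

Definition dedekind_sum (m n : int) : rat :=
  \sum_(1 <= j < (`|n|%N).+1)
     sawtooth ((j%:Z)%:~R / n%:~R) * sawtooth ((m * j%:Z)%:~R / n%:~R).

Definition S12 (m n : int) : rat := 12 * dedekind_sum m n.

(* Main.v *)
(** Write [q = m d - n c] for a fraction [c / d] close to [m / n]. The three-term
    relation between [S (m, n)], [S (c, d)] and a third Dedekind sum with
    denominator [q], combined with the trivial bound [|S (m, n)| <= 3 n], gives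
    [S (m, n) = n / (d q) + O (d + |q|)]. Dirichlet's theorem supplies [c / d] with
    [d <= D] and [|q| <= n / D]. For [D = 6 k (k + 1)] the error is
    less than the gap between [n / k] and [n / (k + 1)], up to a constant
    depending on [k], while [S (k, n) >= n / k - O (k)] by reciprocity. Hence
    [S (m, n) >= S (k, n)] forces [q > 0] and [d q <= k] once [n] is large. *)
Require Import Defs.
From mathcomp Require Import all_boot all_order all_algebra.
From mathcomp Require Import zify ring lra.

Set Implicit Arguments.
Unset Strict Implicit.
Unset Printing Implicit Defensive.

Import Order.TTheory GRing.Theory Num.Theory.
Local Open Scope ring_scope.

(** * Power sums, floor sums and lattice points *)

Lemma sum_ord_id (n : nat) :
  \sum_(j < n) (j%:R : rat) = n%:R * (n%:R - 1) / 2.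
Proof.
elim: n => [|n IH]; first by rewrite big_ord0; field.
by rewrite big_ord_recr /= IH -(natr1 n); field.
Qed.

Lemma sum_ord_sqr (n : nat) :
  \sum_(j < n) (j%:R ^+ 2 : rat) = n%:R * (n%:R - 1) * (2 * n%:R - 1) / 6.
Proof.
elim: n => [|n IH]; first by rewrite big_ord0; field.
by rewrite big_ord_recr /= IH -(natr1 n); field.
Qed.

(** Multiplication by a unit permutes the residues modulo [n]. *)
Lemma sum_mulmod (m n : nat) (F : nat -> rat) : coprime m n ->
  \sum_(j < n) F (m * j %% n)%N = \sum_(j < n) F j.
Proof.
case: n => [|n] co; first by rewrite !big_ord0.
pose h (j : 'I_n.+1) : 'I_n.+1 := inord (m * j %% n.+1).
have hE j : h j = (m * j %% n.+1)%N :> nat by rewrite inordK // ltn_mod.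
rewrite [RHS](@reindex_inj _ _ _ _ h) /=.
  by apply: eq_bigr => j _; rewrite hE.
move=> i j /(congr1 val)/=; rewrite !hE => e; apply: val_inj => /=.
wlog le_ij : i j e / (i <= j)%N.
  by move=> W; case/orP: (leq_total i j) => le; [|symmetry]; apply: W.
have := esym e => /eqP; rewrite eqn_mod_dvd ?leq_mul2l ?le_ij ?orbT //.
rewrite -mulnBr Gauss_dvdr 1?coprime_sym // => dv.
have lt : (j - i < n.+1)%N by rewrite (leq_ltn_trans (leq_subr _ _)).
have [|j0] := posnP (j - i); first lia.
by have := dvdn_leq j0 dv; lia.
Qed.

Lemma mul_divmod (m n j : nat) :
  (m * j %% n)%:R = m%:R * j%:R - n%:R * (m * j %/ n)%:R :> rat.
Proof.
by rewrite -natrM {2}(divn_eq (m * j) n) natrD natrM; ring.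
Qed.

Lemma sum_floor (m n : nat) : coprime m n -> (0 < n)%N ->
  \sum_(j < n) ((m * j %/ n)%:R : rat) = (m%:R - 1) * (n%:R - 1) / 2.
Proof.
move=> co n0; have := @sum_mulmod m n (fun j => j%:R) co.
under eq_bigr => j _ do rewrite mul_divmod.
rewrite sumrB -!mulr_sumr sum_ord_id => e.
have nz : n%:R != 0 :> rat by rewrite pnatr_eq0 -lt0n.
by apply: (mulfI nz); lra.
Qed.

(** Square [m j mod n = m j - n * floor (m j / n)] and sum over [j]: the left side is again a sum of
    all squared residues, so squared floors reduce to the mixed sum. *)
Lemma sum_floor_sqr (m n : nat) : coprime m n ->
  n%:R ^+ 2 * (\sum_(j < n) ((m * j %/ n)%:R ^+ 2 : rat)) =
  2 * m%:R * n%:R * (\sum_(j < n) (j%:R * (m * j %/ n)%:R))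
  - (m%:R ^+ 2 - 1) * (\sum_(j < n) (j%:R ^+ 2)).
Proof.
move=> co; have := @sum_mulmod m n (fun j => j%:R ^+ 2) co.
rewrite (eq_bigr (fun j : 'I_n => m%:R ^+ 2 * j%:R ^+ 2
   - 2 * m%:R * n%:R * (j%:R * (m * j %/ n)%:R)
   + n%:R ^+ 2 * (m * j %/ n)%:R ^+ 2 : rat)); last first.
  by move=> j _; rewrite mul_divmod; ring.
by rewrite big_split sumrB /= -!mulr_sumr => e; lra.
Qed.

(* Count the lattice points [0 < i <= m j / n] with weight [2 i], by rows and
   by columns. *)
Lemma sum_floor_swap (m n : nat) : coprime m n -> (0 < m)%N -> (0 < n)%N ->
  \sum_(j < n) ((m * j %/ n)%:R * ((m * j %/ n)%:R + 1) : rat) =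
  (n%:R - 1) * (m%:R * (m%:R - 1))
  - 2 * (\sum_(i < m) (i%:R * (n * i %/ m)%:R)).
Proof.
move=> co m0 n0.
have row (j : 'I_n) : (m * j %/ n)%:R * ((m * j %/ n)%:R + 1) =
    \sum_(i < m) (if (i * n <= m * j)%N then 2 * i%:R else 0) :> rat.
  (* The condition on [i] is [i <= t], and the weights [2 i] up to [t] add up to [t (t + 1)]. *)
  set t := (m * j %/ n)%N.
  have lt : (t < m)%N by rewrite ltn_divLR // ltn_mul2l m0 ltn_ord.
  rewrite (eq_bigr (fun i : 'I_m => if (i < t.+1)%N then 2 * i%:R else 0));
    last by move=> i _; rewrite ltnS leq_divRL.
  rewrite -big_mkcond /= (big_ord_narrow lt) /= -mulr_sumr.
  by rewrite sum_ord_id -natr1; field.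
under eq_bigr => j _ do rewrite row.
rewrite exchange_big /=.
have col (i : 'I_m) :
    \sum_(j < n) (if (i * n <= m * j)%N then 2 * i%:R else 0 : rat) =
    2 * (n%:R - 1) * i%:R - 2 * (i%:R * (n * i %/ m)%:R).
  have [i0|i0] := posnP i.
    by rewrite big1 ?i0 => *; rewrite ?mulr0 ?mul0r ?if_same; ring.
  set t := (n * i %/ m)%N.
  have lt : (t < n)%N by rewrite ltn_divLR // ltn_mul2l n0 ltn_ord.
  (* No lattice point lies on the line: equality would make [m] divide [i], while [0 < i < m]. Hence
     the column is exactly [j > t]. *)
  have eqc (j : 'I_n) : (i * n <= m * j)%N = ~~ (j < t.+1)%N.
    rewrite ltnS leq_divRL // -ltnNge mulnC (mulnC m) leq_eqVlt.
    case: eqP => // e; exfalso.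
    have : (m %| n * i)%N by rewrite e dvdn_mull.
    rewrite Gauss_dvdr // => /(dvdn_leq i0); have := ltn_ord i; lia.
  rewrite (eq_bigr (fun j : 'I_n =>
      2 * i%:R - (if (j < t.+1)%N then 2 * i%:R else 0))); last first.
    by move=> j _; rewrite eqc; case: (_ < _)%N => /=; ring.
  rewrite sumrB -[X in _ - X]big_mkcond /= (big_ord_narrow lt) /=.
  by rewrite !sumr_const !card_ord -!(mulr_natr (2 * i%:R)) -natr1; ring.
under eq_bigr => i _ do rewrite col.
by rewrite sumrB -!mulr_sumr sum_ord_id; field.
Qed.

(** * Elementary properties of the sawtooth function *)

Lemma sawtooth_int (z : int) : sawtooth z%:~R = 0.
Proof. by rewrite /sawtooth intr_int. Qed.

Lemma sawtoothDz (t : rat) (z : int) : sawtooth (t + z%:~R) = sawtooth t.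
Proof.
rewrite /sawtooth rpredDr ?intr_int // floorDrz ?intr_int // intrKfloor //.
by case: ifP => // _; rewrite intrD; ring.
Qed.

Lemma sawtoothN (t : rat) : sawtooth (- t) = - sawtooth t.
Proof.
rewrite /sawtooth rpredN; case: ifPn => [_|tN]; first by rewrite oppr0.
have /andP[le lt] := floor_itv t.
have ne : (Num.floor t)%:~R != t.
  by apply: contra tN => /eqP <-; exact: intr_int.
rewrite (@floor_def _ (- t) (- Num.floor t - 1)); last first.
  rewrite subrK intrB !rmorphN /= lerNr ltrN2 lt_neqAle ne le andbT.
  by move: lt; rewrite intrD rmorph1; lra.
by rewrite intrB rmorphN /=; field.
Qed.

Lemma sawtooth_le (t : rat) : `|sawtooth t| <= 2^-1.
Proof.
rewrite /sawtooth; case: ifP => _; first by rewrite normr0.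
have := floor_itv t; rewrite intrD rmorph1 => /andP[le lt].
by rewrite ler_norml; apply/andP; split; lra.
Qed.

Lemma sawtooth_frac (r n : nat) : (r < n)%N ->
  sawtooth (r%:R / n%:R) = if r == 0%N then 0 else r%:R / n%:R - 2^-1.
Proof.
move=> lt; have n0 : 0 < n%:R :> rat by rewrite ltr0n (leq_ltn_trans _ lt).
have fl : Num.floor (r%:R / n%:R : rat) = 0.
  apply: floor_def; rewrite add0r divr_ge0 ?ler0n //=.
  by rewrite ltr_pdivrMr // mul1r ltr_nat.
have [->|r0] := eqVneq r 0%N; first by rewrite mul0r /sawtooth rpred0.
rewrite /sawtooth ifF ?fl; first by rewrite subr0.
apply/negP => /intrP[z ez]; move: fl; rewrite ez intrKfloor // => z0.
move: ez; rewrite z0 => /eqP; rewrite mulf_eq0 invr_eq0 pnatr_eq0 (negbTE r0).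
by rewrite gt_eqF.
Qed.

(** * Residue-sum formula and reciprocity law *)

Lemma S12E (m n : nat) : coprime m n -> (0 < n)%N ->
  S12 m n = 12 / n%:R ^+ 2 * (\sum_(j < n) (j%:R * (m * j %% n)%:R))
            - 3 * (n%:R - 1).
Proof.
move=> co n0; rewrite /S12 /dedekind_sum /=.
have nz : n%:R != 0 :> rat by rewrite pnatr_eq0 -lt0n.
rewrite big_nat_recr //= divff // (sawtooth_int 1) mul0r addr0.
(* The expanded product of two sawtooth values; the last summand cancels the spurious [1/4] at
   [j = 0]. *)
pose F j : rat := j%:R * (m * j %% n)%:R / n%:R ^+ 2 - j%:R / (2 * n%:R)
  - (m * j %% n)%:R / (2 * n%:R) + (4^-1 - (if j == 0%N then 4^-1 else 0)).
transitivity (12 * \sum_(j < n) F j).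
  congr (12 * _); rewrite -(big_mkord predT F) [RHS]big_ltn //=.
  have -> : F 0%N = 0 by rewrite /F muln0 mod0n /=; field.
  rewrite add0r.
  apply: eq_big_nat => j /andP[j1 jn].
  have rn : (m * j %% n < n)%N by rewrite ltn_mod.
  rewrite (_ : (Posz m * Posz j)%:~R / n%:~R = (m * j %% n)%:R / n%:R
      + (m * j %/ n)%N%:~R); last first.
    by rewrite mul_divmod -PoszM -!pmulrn natrM; field.
  rewrite sawtoothDz -!pmulrn !sawtooth_frac // /F.
  rewrite !eqn0Ngt j1 /= ifF; first by field.
  rewrite -eqn0Ngt -/(dvdn n (m * j)%N); apply/negP.
  rewrite Gauss_dvdr 1?coprime_sym //.
  by move/(dvdn_leq j1); rewrite leqNgt jn.
rewrite /F big_split !sumrB /= -!mulr_suml (@sum_mulmod m n (fun j => j%:R)) //.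
rewrite !sum_ord_id sumr_const card_ord -(mulr_natr 4^-1).
have -> : \sum_(j < n) (if j == 0%N :> nat then 4^-1 else 0 : rat) = 4^-1.
  rewrite -big_mkcond; case: n n0 {co F nz} => // n _.
  by rewrite (big_pred1 ord0).
by field.
Qed.

(** Both sums reduce to mixed sums [A] and [B]. The lattice count expresses [B] by the sum [Q] of
    squared floors, and the squared residues express [Q] by [A]; then [A] cancels. *)
Lemma S12_reciprocity (m n : nat) : coprime m n -> (0 < m)%N -> (0 < n)%N ->
  S12 m n + S12 n m = m%:R / n%:R + n%:R / m%:R + (m%:R * n%:R)^-1 - 3.
Proof.
move=> co m0 n0; rewrite !S12E // 1?coprime_sym //.
have mz : m%:R != 0 :> rat by rewrite pnatr_eq0 -lt0n.
have nz : n%:R != 0 :> rat by rewrite pnatr_eq0 -lt0n.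
have expand (a b : nat) : \sum_(j < b) (j%:R * (a * j %% b)%:R : rat) =
    a%:R * (\sum_(j < b) j%:R ^+ 2)
    - b%:R * \sum_(j < b) (j%:R * (a * j %/ b)%:R).
  by rewrite !mulr_sumr -sumrB; apply: eq_bigr => j _; rewrite mul_divmod; ring.
rewrite !expand !sum_ord_sqr.
have := sum_floor_swap co m0 n0.
under eq_bigr => j _ do rewrite mulrDr mulr1 -expr2.
rewrite big_split /= (sum_floor co n0).
have := sum_floor_sqr co; rewrite sum_ord_sqr.
set A := \sum_(j < n) (j%:R * _); set B := \sum_(j < m) (j%:R * _).
set Q := \sum_(j < n) (_ ^+ 2); move=> eA eB.
have -> : B = ((n%:R - 1) * (m%:R * (m%:R - 1))
   - (Q + (m%:R - 1) * (n%:R - 1) / 2)) / 2.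
  by rewrite eB; field.
have -> : Q = (2 * m%:R * n%:R * A - (m%:R ^+ 2 - 1) *
   (n%:R * (n%:R - 1) * (2 * n%:R - 1) / 6)) / n%:R ^+ 2.
  by rewrite -eA; field.
by field; rewrite mz nz.
Qed.

(** * Periodicity, oddness and the trivial bound *)

Lemma S12_mod (m n t : int) : n != 0 -> S12 (m + t * n) n = S12 m n.
Proof.
move=> nz; congr (12 * _); apply: eq_big_nat => j _; congr (_ * _).
have nzr : n%:~R != 0 :> rat by rewrite intr_eq0.
rewrite -[RHS](sawtoothDz _ (t * j)); congr sawtooth.
by rewrite !rmorphM rmorphD rmorphM /=; field.
Qed.

Lemma S12N (m n : int) : S12 (- m) n = - S12 m n.
Proof.
rewrite /S12 /dedekind_sum -mulrN -sumrN; congr (12 * _).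
apply: eq_big_nat => j _.
rewrite -mulrN -sawtoothN; congr (_ * sawtooth _).
by rewrite mulNr rmorphN mulNr.
Qed.

Lemma S12_norm_le (m n : int) : `|S12 m n| <= 3 * `|n|%:~R.
Proof.
rewrite /S12 /dedekind_sum normrM ger0_norm // (_ : 3 = 12 * 4^-1); last by field.
rewrite -mulrA ler_pM2l //; apply: le_trans (ler_norm_sum _ _ _) _.
apply: (@le_trans _ _ (\sum_(1 <= j < `|n|.+1) 4^-1)).
  apply: ler_sum => j _; rewrite normrM (_ : 4^-1 = 2^-1 * 2^-1); last by field.
  by apply: ler_pM => //; apply: sawtooth_le.
by rewrite sumr_const_nat subn1 /= -abszE -pmulrn mulr_natr.
Qed.

Lemma S120 (n : int) : S12 0 n = 0.
Proof. by have := S12N 0 n; rewrite oppr0; lra. Qed.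

Lemma S12_reciprocity_int (m n : int) : coprimez m n -> 0 < m -> 0 < n ->
  S12 m n = m%:~R / n%:~R + n%:~R / m%:~R + (m%:~R * n%:~R)^-1 - 3 - S12 n m.
Proof.
case: m => // m; case: n => // n; rewrite !ltz_nat => co m0 n0.
by rewrite -!pmulrn -(S12_reciprocity co m0 n0) addrK.
Qed.

(** * The three-term estimate *)

(** This is [(n^2 + d^2 + q^2) / (n d q)], the rational part of the three-term relation. *)
Definition main_term (n d q : rat) : rat :=
  n / (d * q) + d / (n * q) + q / (n * d).

(** The correction terms are those of the reciprocity laws for [(m, n)] and [(c, d)], so they cancel
    in the Euclidean step. *)
Lemma main_term_swap (m n c d q : rat) :
  m != 0 -> n != 0 -> c != 0 -> d != 0 -> q != 0 -> q = m * d - n * c ->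
  main_term n d q = main_term m c q + (m / n + n / m + (m * n)^-1)
                    - (c / d + d / c + (c * d)^-1).
Proof.
move=> mz nz cz dz qz e; rewrite /main_term.
move: qz; rewrite e => qz; field; rewrite mz nz cz dz qz //.
Qed.

(* The reciprocity law makes the quantity in the norm invariant under
   [(m, n, c, d) -> (- n, m, - d, c)], and it is clearly invariant under
   [(m, n, c, d) -> (m - t n, n, c - t d, d)]; both maps preserve
   [q = m d - n c], so the Euclidean algorithm on [(c, d)] leads to [c / d = 0 / 1]. *)
Lemma three_term_bound (m n c d q : int) :
  coprimez m n -> coprimez c d -> 0 < n -> 0 < d -> 0 < q -> q = m * d - n * c ->
  `|S12 m n - S12 c d + 3 - main_term n%:~R d%:~R q%:~R| <= 3 * q%:~R :> rat.
Proof.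
move=> + + + d0 q0; case: d d0 => [d|d] d0; last by exfalso; move: d0.
elim/ltn_ind: d m n c d0 => d IH m n c d0 co_mn co_cd n0 eq_q.
set t := (c %/ d)%Z; pose c0 := (c %% d)%Z; pose m0 := m - t * n.
have ec : c = c0 + t * d by rewrite addrC -divz_eq.
have em : m = m0 + t * n by rewrite subrK.
have c0d : (c0 < d)%R by rewrite ltz_pmod.
have c0_ge0 : 0 <= c0 by rewrite modz_ge0 // gt_eqF.
have eq_q0 : q = m0 * d - n * c0 by rewrite eq_q ec em; ring.
have co_mn0 : coprimez m0 n.
  by move: co_mn; rewrite em coprimez_sym /coprimez addrC gcdzMDl gcdzC.
have co_cd0 : coprimez c0 d.
  by move: co_cd; rewrite ec coprimez_sym /coprimez addrC gcdzMDl gcdzC.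
rewrite em ec (S12_mod m0 t (lt0r_neq0 n0)) (S12_mod c0 t (lt0r_neq0 d0)).
clearbody m0 c0; clear m c t em ec co_mn co_cd eq_q.
case: c0 c0d c0_ge0 eq_q0 co_cd0 => [c|c] lt_cd c_ge0 eq_q co_cd; last first.
  by exfalso; move: c_ge0.
have nz : n%:~R != 0 :> rat by rewrite intr_eq0 gt_eqF.
have [c_eq0|c_gt0] := posnP c.
  (* Here [d = 1] and [q = m0], so by reciprocity only [- S12 n m0] remains, and the trivial bound
     gives [3 q]. *)
  move: co_cd eq_q; rewrite c_eq0 /coprimez gcd0z => /eqP -[d1].
  rewrite d1 mulr1 mulr0 subr0 => eq_qm; rewrite eq_qm in q0 *.
  have mz : m0%:~R != 0 :> rat by rewrite intr_eq0 gt_eqF.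
  rewrite (S12_reciprocity_int co_mn0) // S120.
  rewrite [X in `|X|](_ : _ = - S12 n m0); last first.
    by rewrite /main_term rmorph1; field; rewrite mz nz.
  by rewrite normrN -{2}(gtr0_norm q0) S12_norm_le.
have m0_gt0 : 0 < m0.
  by rewrite -(pmulr_lgt0 _ d0) (_ : m0 * d = q + n * c); [nia|rewrite eq_q; ring].
have := IH c lt_cd (- n) m0 (- Posz d) c_gt0.
rewrite !coprimeNz coprimez_sym co_mn0 coprimez_sym co_cd.
have -> : - n * c - m0 * - Posz d = q by rewrite eq_q; ring.
move=> /(_ isT isT m0_gt0 erefl); rewrite !S12N.
rewrite (S12_reciprocity_int co_mn0) // (S12_reciprocity_int co_cd) //.
congr (`|_| <= _).
rewrite (@main_term_swap m0%:~R n%:~R c%:~R d%:~R) ?intr_eq0 ?gt_eqF //.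
  by ring.
by rewrite eq_q rmorphB !rmorphM.
Qed.

(** The trivial bound on [S12 c d] costs [3 d]. For [q < 0] the estimate is applied to [- m] and
    [- c]; the main term then enters with a negative sign and is dropped. *)
Lemma S12_le_approx (m n c d q : int) :
  coprimez m n -> coprimez c d -> 0 < n -> 0 < d -> q != 0 -> q = m * d - n * c ->
  S12 m n <= 3 * d%:~R + 3 * `|q|%:~R + 3
    + (if 0 < q then main_term n%:~R d%:~R q%:~R else 0).
Proof.
move=> co_mn co_cd n0 d0 qz eq_q.
have := S12_norm_le c d; rewrite (gtr0_norm d0) => /ler_normlP[_ Sc].
have [q0|q0] := boolP (0 < q).
  have /ler_normlP[_] := three_term_bound co_mn co_cd n0 d0 q0 eq_q.
  by rewrite (gtr0_norm q0); lra.
have q_lt0 : q < 0 by rewrite lt_neqAle qz leNgt.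
have Nq0 : 0 < - q by rewrite oppr_gt0.
have := @three_term_bound (- m) n (- c) d (- q).
rewrite !coprimeNz !S12N => /(_ co_mn co_cd n0 d0 Nq0).
rewrite eq_q => /(_ _)/ler_normlP[]; first by ring.
rewrite -eq_q (ltr0_norm q_lt0).
have : 0 <= main_term n%:~R d%:~R (- q)%:~R.
  by rewrite /main_term !addr_ge0 // divr_ge0 ?mulr_ge0 // ler0z ltW.
lra.
Qed.

(** * Dirichlet approximation *)

Lemma dirichlet_approx (m n D : nat) : (0 < n)%N -> (0 < D)%N ->
  exists c d : nat, [/\ (0 < d <= D)%N, coprime c d &
    (D * `|(m * d)%N%:Z - (n * c)%N%:Z| <= n)%N].
Proof.
move=> n0 D0.
suff [c [d [d0 dD le]]] : exists c d : nat, [/\ (0 < d)%N, (d <= D)%N &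
    (D * `|(m * d)%N%:Z - (n * c)%N%:Z| <= n)%N].
  (* Cancelling the gcd increases neither [d] nor the error. *)
  have g0 : (0 < gcdn c d)%N by rewrite gcdn_gt0 d0 orbT.
  have ec := divnK (dvdn_gcdl c d); have ed := divnK (dvdn_gcdr c d).
  exists (c %/ gcdn c d)%N, (d %/ gcdn c d)%N; split.
  - by rewrite divn_gt0 // dvdn_leq ?dvdn_gcdr // (leq_trans (leq_div _ _)).
  - by rewrite /coprime -(eqn_pmul2r g0) muln_gcdl ec ed mul1n.
  apply: leq_trans le; rewrite leq_mul2l; apply/orP; right.
  move: (gcdn c d) (c %/ _)%N (d %/ _)%N g0 ec ed => g c' d' g0 <- <-.
  by rewrite !mulnA 2!(PoszM _ g) -mulrBl abszM leq_pmulr.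
(* Pigeonhole: [D + 1] residues [m j mod n] fall into [D] boxes of length [n / D]. *)
have f_lt (j : 'I_D.+1) : (m * j %% n * D %/ n < D)%N.
  by rewrite ltn_divLR // mulnC ltn_pmul2l // ltn_mod.
pose f j := Ordinal (f_lt j).
have /injectivePn[i [j ij eq_f]] : ~~ injectiveb f.
  by apply/injectiveP => /leq_card; rewrite !card_ord ltnn.
wlog lt_ij : i j ij eq_f / (i < j)%N.
  move=> W; case: (ltngtP i j) => [lt|lt|/val_inj e]; first exact: W lt.
    by apply: W lt => //; rewrite eq_sym.
  by rewrite e eqxx in ij.
exists (m * j %/ n - m * i %/ n)%N, (j - i)%N; split.
- by rewrite subn_gt0.
- by rewrite (leq_trans (leq_subr _ _)) // -ltnS.
have le_q : (m * i %/ n <= m * j %/ n)%N by rewrite leq_div2r // leq_mul2l ltnW ?orbT.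
have le_m : (m * i <= m * j)%N by rewrite leq_mul2l ltnW ?orbT.
have -> : (m * (j - i))%N%:Z - (n * (m * j %/ n - m * i %/ n))%N%:Z
          = (m * j %% n)%N%:Z - (m * i %% n)%N%:Z.
  have := divn_eq (m * i) n; have := divn_eq (m * j) n.
  have : (m * i %/ n * n <= m * j %/ n * n)%N by rewrite leq_mul2r le_q orbT.
  rewrite !mulnBr !(mulnC n).
  move: (m * j)%N (m * i)%N (m * j %/ n * n)%N (m * i %/ n * n)%N
    (m * j %% n)%N (m * i %% n)%N le_m; lia.
have {eq_f} := congr1 val eq_f => /=.
set ri := (m * i %% n)%N; set rj := (m * j %% n)%N => eq_f.
rewrite mulnC -(absz_nat D) -abszM mulrBl -!PoszM.
have := divn_eq (ri * D) n; have := divn_eq (rj * D) n; rewrite eq_f.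
have := ltn_pmod (ri * D) n0; have := ltn_pmod (rj * D) n0.
move: (rj * D %% n)%N (ri * D %% n)%N (rj * D %/ n * n)%N (rj * D)%N (ri * D)%N.
by clear; lia.
Qed.

(** * Comparison of the two bounds for large [n] *)

Theorem theorem1 :
  forall k : nat, (0 < k)%N ->
  exists N : nat,
    forall n m : nat,
      (maxn k N < n)%N -> coprime k n ->
      (m < n)%N -> coprime m n ->
      (S12 (Posz k) (Posz n) <= S12 (Posz m) (Posz n))%R ->
      exists d c q : nat,
        [/\ (1 <= d <= k)%N, (c < d)%N, coprime c d,
            (1 <= q <= k %/ d)%N &
            (m%:R : rat) = ((n * c + q)%N%:R / d%:R)%R].
Proof.
(* With [u = n/k - n/(k+1)], this [D] gives [3 |q| <= u/2]. [C] collects [3 d <= 3 D], the [3] of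
   the upper bound, the [3 + 3 k] of the lower bound and [1 + 1] from the small parts of the main
   term; the choice of [N] gives [C < u/2] and [D < n]. *)
move=> k k0; pose D := (6 * k * k.+1)%N; pose C := (3 * D + 3 * k + 8)%N.
exists (D + 2 * k * k.+1 * C)%N => n m; rewrite gtn_max => /andP[lt_kn lt_Nn].
move=> co_kn lt_mn co_mn le_S.
have n0 : (0 < n)%N by lia.
have D0 : (0 < D)%N by rewrite !muln_gt0 k0.
have [c [d [/andP[d0 dD] co_cd le_q]]] := dirichlet_approx m n0 D0.
move: le_q; set q := (Posz _ - Posz _) => le_q.
have eq_q : q = Posz m * Posz d - Posz n * Posz c by rewrite -!PoszM.
have qz : q != 0.
  (* If [q = 0] then [n] divides [d], but [d <= D < n]. *)
  apply/eqP => q_eq0; have : (n %| m * d)%N.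
    by apply/dvdnP; exists c; rewrite mulnC; lia.
  rewrite Gauss_dvdr 1?coprime_sym // => /(dvdn_leq d0); lia.
clearbody q.
have lower : n%:R / k%:R - 3 - 3 * k%:R <= S12 k n.
  have := S12_reciprocity co_kn k0 n0.
  have := S12_norm_le n k; rewrite -pmulrn => /ler_normlP[_ le].
  have : 0 <= k%:R / n%:R + (k%:R * n%:R)^-1 :> rat.
    by rewrite -natrM addr_ge0 ?divr_ge0 ?invr_ge0 ?ler0n.
  lra.
have := @S12_le_approx m n c d q co_mn co_cd n0 d0 qz eq_q.
have nR : 1 <= n%:R :> rat by rewrite ler1n.
have d_ge1 : 1 <= d%:R :> rat by rewrite ler1n.
have d_leD : d%:R <= D%:R :> rat by rewrite ler_nat.
have kR : 1 <= k%:R :> rat by rewrite ler1n.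
have kk0 : 0 < k%:R * (k%:R + 1) :> rat by rewrite mulr_gt0; lra.
have kk := lt0r_neq0 kk0.
pose u : rat := n%:R / (k%:R * (k%:R + 1)).
have n_over_k : n%:R / k%:R = n%:R / (k%:R + 1) + u.
  by move: kk; rewrite mulf_eq0 negb_or => /andP[? ?]; rewrite /u; field; apply/andP.
have q_le : 3 * `|q|%:~R <= u / 2.
  have : D%:R * `|q|%:~R <= n%:R :> rat by rewrite -abszE -natrM ler_nat.
  have -> : n%:R = u * (k%:R * (k%:R + 1)) by rewrite divfK.
  rewrite /D !natrM -(natr1 k) => le.
  by rewrite -(ler_pM2r kk0); lra.
have C_lt : 3 * D%:R + 3 * k%:R + 8 < u / 2.
  have : (2 * k * k.+1 * C)%N%:R < n%:R :> rat by rewrite ltr_nat; lia.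
  rewrite /C !natrM !natrD !natrM -(natr1 k).
  have -> : n%:R = u * (k%:R * (k%:R + 1)) by rewrite divfK.
  by move=> lt; rewrite -(ltr_pM2r kk0); lra.
have n_over_k1 : 0 <= n%:R / (k%:R + 1) :> rat by rewrite divr_ge0; lra.
(* Without a main term the upper bound stays below [n / k - 3 - 3 k], so [q > 0]. *)
rewrite -!pmulrn; case: ifP => [q0|_] upper; last by exfalso; lra.
have q_len : (`|q| <= n)%N by exact: leq_trans (leq_pmull _ D0) le_q.
case: q q0 eq_q {qz le_q} q_le q_len upper => [q|q] q0 eq_q q_le q_len; last first.
  by exfalso; move: q0.
move=> /= upper.
have {}q_le : 3 * q%:R <= u / 2 := q_le.
have {}upper : S12 m n <= 3 * d%:R + 3 * q%:R + 3 + main_term n%:R d%:R q%:R :=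
  upper.
have eq_m : (m * d = n * c + q)%N.
  by apply/eqP; rewrite -eqz_nat PoszD !PoszM eq_q addrC subrK.
have dq_le : (d * q <= k)%N.
  rewrite leqNgt; apply/negP => lt_k.
  (* From [d q >= k + 1] the leading part is at most [n / (k + 1)], and the other two are at most
     [1] as [d, q <= n]; the errors stay below the gap [u]. *)
  suff : main_term n%:R d%:R q%:R <= n%:R / (k%:R + 1) + 1 + 1 by lra.
  have lt_dn : (d < n)%N := leq_ltn_trans dD (leq_ltn_trans (leq_addr _ _) lt_Nn).
  have q1 : (1 <= q)%N by rewrite -ltz_nat q0.
  rewrite /main_term natr1 -!natrM; apply: lerD; first apply: lerD.
  - rewrite ler_wpM2l ?ler0n // lef_pV2 ?posrE ?ltr0n ?muln_gt0 ?d0 //.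
    by rewrite ler_nat.
  - rewrite ler_pdivrMr ?ltr0n ?muln_gt0 ?n0 // mul1r ler_nat.
    by rewrite (leq_trans (ltnW lt_dn)) ?leq_pmulr.
  - rewrite ler_pdivrMr ?ltr0n ?muln_gt0 ?n0 // mul1r ler_nat.
    by rewrite (leq_trans q_len) ?leq_pmulr.
exists d, c, q; split.
- by rewrite d0 (leq_trans _ dq_le) // leq_pmulr.
(* [n c <= n c + q = m d < n d]. *)
- by rewrite -(ltn_pmul2l n0) (leq_ltn_trans (leq_addr q _)) // -eq_m ltn_pmul2r.
- exact: co_cd.
- by rewrite leq_divRL // mulnC dq_le -ltz_nat q0.
- by rewrite -eq_m natrM mulfK // pnatr_eq0 -lt0n.
Qed.
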